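(* Let $(X,\mu)$ be a standard probability space, $f:X\to X$ an ergodic invertible measure-preserving transformation, $(Y,\nu)$ a standard probability space, $M=L^\infty(Y,\nu)$ and $\tau(\phi)=\int\phi\,d\nu$. Let $c:\mathbb{Z}\times X\to M^\times\cap\mathrm{GL}^2(M,\tau)$ satisfy $c(n+m,x)=c(n,f^mx)c(m,x)$ for all $n,m\in\mathbb{Z}$ and a.e. $x$, be measurable for the Strong Operator Topology, and satisfy $\int_X\|\log(|c(1,x)|)\|_2\,d\mu(x)<\infty$. For a.e. $x$ let $\Lambda(x)>0$ be the limit operator, $\log\Lambda(x)=\lim_{n\to\infty}n^{-1}\log|c(n,x)|$ in $L^2(Y,\nu)$. Then for a.e. $x$, $\log\big([c(n,x)^*c(n,x)]^{1/2n}\big)$ converges to $\log\Lambda(x)$ almost uniformly; that is, for every $\varepsilon>0$ and for a.e. $x$ there exists a closed subspace $S(x)\subset L^2(M,\tau)=L^2(Y,\nu)$ whose orthogonal projection $p_{S(x)}$ satisfies $p_{S(x)}\in M$, $\tau(I-p_{S(x)})<\varepsilon$ and $$\lim_{n\to\infty}\log\big([c(n,x)^*c(n,x)]^{1/2n}\big)p_{S(x)}=\log(\Lambda(x))\,p_{S(x)}$$ with convergence in operator norm.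
   Context: $M=L^\infty(Y,\nu)$ acts on $L^2(Y,\nu)$ by multiplication operators, and functions are identified with the corresponding multiplication operators; a projection in $M$ is a characteristic function $1_Z$, $Z\subset Y$ measurable. $M^\times$ is the set of $\phi\in L^\infty(Y,\nu)$ with $1/\phi\in L^\infty(Y,\nu)$. $\mathrm{GL}^2(M,\tau)$ is the set of (classes of) a.e. nonzero measurable functions $\phi:Y\to\mathbb{C}$ with $\log|\phi|\in L^2(Y,\nu)$. $\|\cdot\|_2$ is the $L^2(Y,\nu)$-norm. The $L^2$-limit defining $\log\Lambda(x)$ exists for a.e. $x$ under the stated hypotheses. *)

(* Defs.v *)
From HB Require Import structures.
From mathcomp Require Import all_boot all_order all_algebra.
From mathcomp Require Import complex.
From mathcomp Require Import all_classical all_reals all_analysis.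
Set Implicit Arguments.
Unset Strict Implicit.
Unset Printing Implicit Defensive.
Import Order.TTheory GRing.Theory Num.Theory.
Import numFieldNormedType.Exports.
Local Open Scope classical_set_scope.
Local Open Scope ring_scope.
Local Open Scope complex_scope.

(* A standard probability space is a standard Borel space (the Borel
   sigma-algebra of a separable complete metric space) with a probability. *)
Definition standard_borel (R : realType) (d : measure_display)
    (T : measurableType d) : Prop :=
  exists (P : completePseudoMetricType R) (g : T -> P),
    [/\ hausdorff_space P,
        exists2 D : set P, countable D & dense D,
        bijective g &
        forall A : set T, measurable A <->
          exists2 B : set P, <<s [set U : set P | open U] >> B & A = g @^-1` B].

Section dynamics.
Context (R : realType) (d : measure_display) (X : measurableType d).
Variable mu : probability X R.

Definition measure_preserving (f : X -> X) : Prop :=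
  measurable_fun setT f /\ forall A, measurable A -> mu (f @^-1` A) = mu A.

Definition ergodic (f : X -> X) : Prop :=
  forall A, measurable A -> f @^-1` A = A -> mu A = 0%E \/ mu A = 1%E.

Definition iterz (f finv : X -> X) (n : int) : X -> X :=
  match n with
  | Posz k => iter k f
  | Negz k => iter k.+1 finv
  end.

End dynamics.

(* Elements of L^2 and L^oo, and more generally classes of measurable functions,
   are handled through representatives Y -> R[i]; every notion below is
   invariant under almost everywhere equality of measurable functions. *)
Section function_spaces.
Context (R : realType) (d : measure_display) (Y : measurableType d).
Variable nu : probability Y R.
Implicit Types (phi psi xi eta p : Y -> R[i]) (S U : set (Y -> R[i])).

Definition cmeasurable phi : Prop :=
  measurable_fun setT (fun y => complex.Re (phi y)) /\
  measurable_fun setT (fun y => complex.Im (phi y)).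

Definition cabs phi : Y -> R := fun y => complex.Re `|phi y|.

Definition LC (q : \bar R) : set (Y -> R[i]) :=
  [set phi | cmeasurable phi /\ finite_norm nu q (cabs phi)].

Definition L2norm xi : \bar R := Lnorm nu 2%:E (EFin \o cabs xi).

Definition cintegral phi : R[i] :=
  (\int[nu]_y complex.Re (phi y)) +i* (\int[nu]_y complex.Im (phi y)).

Definition tau phi : R[i] := cintegral phi.

Definition L2dot xi eta : R[i] := cintegral (fun y => xi y * (eta y)^*).

Definition mulop phi xi : Y -> R[i] := fun y => phi y * xi y.

(* Multiplication by phi may be unbounded on L^2, in which case the value
   is +oo. *)
Definition opnorm phi : \bar R :=
  ereal_inf [set r%:E | r in [set r : R | 0 <= r /\
    forall xi, LC 2%:E xi -> (L2norm (mulop phi xi) <= r%:E * L2norm xi)%E]].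

(* The condition phi != 0 makes up for the convention 0^-1 = 0. *)
Definition Mtimes : set (Y -> R[i]) :=
  [set phi | [/\ LC +oo%E phi, \forall y \ae nu, phi y != 0 &
                 LC +oo%E (fun y => (phi y)^-1)]].

Definition log_abs phi : Y -> R := fun y => ln (cabs phi y).

Definition GL2 : set (Y -> R[i]) :=
  [set phi | [/\ cmeasurable phi, \forall y \ae nu, phi y != 0 &
                 finite_norm nu 2%:E (log_abs phi)]].

(* log ([phi^* phi]^(1/2n)); the functional calculus of multiplication
   operators is pointwise, and phi^* phi is real and nonnegative. *)
Definition log_root_absq (n : nat) phi : Y -> R :=
  fun y => ln (complex.Re ((phi y)^* * phi y) `^ ((2 * n)%:R)^-1).

(* Open sets of the strong operator topology on L^oo, given by the seminorms
   phi |-> ||phi xi||_2 for xi in L^2. *)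
Definition SOT_open U : Prop :=
  U `<=` LC +oo%E /\
  forall phi, U phi -> exists (k : nat) (xi : 'I_k -> Y -> R[i]) (e : R),
    [/\ forall i, LC 2%:E (xi i),
        0 < e &
        forall psi, LC +oo%E psi ->
          (forall i, (L2norm (mulop (fun y => psi y - phi y)%R (xi i))
            < e%:E)%E) ->
          U psi].

Definition SOT_measurable (dX : measure_display) (X : measurableType dX)
    (F : X -> Y -> R[i]) : Prop :=
  forall U, SOT_open U -> measurable (F @^-1` U).

Definition closed_subspace S : Prop :=
  [/\ S `<=` LC 2%:E,
      S (cst 0),
      forall (a : R[i]) xi eta, S xi -> S eta -> S (fun y => a * xi y + eta y) &
      forall (u : nat -> Y -> R[i]) xi, (forall n, S (u n)) -> LC 2%:E xi ->
        L2norm (fun y => u n y - xi y) @[n --> \oo] --> 0%E -> S xi].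

(* Multiplication by p is the orthogonal projection of L^2 onto S. *)
Definition orthogonal_projection S p : Prop :=
  forall xi, LC 2%:E xi ->
    S (mulop p xi) /\
    forall eta, S eta -> L2dot (fun y => xi y - mulop p xi y) eta = 0.

Definition cvg_almost_uniformly (T : nat -> Y -> R) (L : Y -> R) : Prop :=
  forall eps : R, 0 < eps ->
    exists (S : set (Y -> R[i])) (p : Y -> R[i]),
      [/\ closed_subspace S,
          LC +oo%E p,
          orthogonal_projection S p,
          tau (fun y => 1 - p y) < eps%:C &
          opnorm (fun y => (T n y)%:C * p y - (L y)%:C * p y)
            @[n --> \oo] --> 0%E].

End function_spaces.

(* Main.v *)
Require Import Defs.
From HB Require Import structures.
From mathcomp Require Import all_boot all_order all_algebra.
From mathcomp Require Import complex.
From mathcomp Require Import all_classical all_reals all_analysis.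
From mathcomp Require Import measurable_realfun ess_sup_inf.
From mathcomp Require Import lra ring.
Set Implicit Arguments.
Unset Strict Implicit.
Unset Printing Implicit Defensive.
Import Order.TTheory GRing.Theory Num.Theory.
Import numFieldNormedType.Exports.
Local Open Scope classical_set_scope.
Local Open Scope ring_scope.
Local Open Scope complex_scope.

(** The operators involved are multiplications by functions on [Y], and
   [log ([c(n,x)^* c(n,x)]^(1/2n))] is multiplication by [n^-1 log |c(n,x)|]
   ([log_root_absqE]). By Egorov's theorem, almost uniform convergence follows
   once, for almost every [x], this sequence converges to [log (Lambda x)]
   almost everywhere on [Y] ([cvg_almost_uniformly_of_ae]): the projection is
   the characteristic function of a set on which the convergence is uniform.

   By the cocycle relation, [log |c(n,x)(y)|] is the Birkhoff sum at [(x, y)] of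
   the function [phi (x, y) = log |c(1,x)(y)|] for the map [f x id], which
   preserves the product measure [mu x nu] ([log_abs_cocycle]). The integral of
   [|phi|] is at most the integral of the [L^2] norms of its sections, which is
   finite. Birkhoff's pointwise theorem therefore applies on [X x Y]. Only the
   following half of it is needed: for rationals [a < b], at almost every point
   the Birkhoff sums [S n] are such that [S n - b n] and [a n - S n] are not both
   unbounded above ([birkhoff_no_oscillation]); this is a direct consequence of the maximal
   ergodic theorem, proved by Garsia's argument ([maximal_ergodic]).
   On the other hand the [L^2] convergence to [log (Lambda x)] forces the
   averages to come back arbitrarily close to [log (Lambda x) y] for almost every
   [y] ([frequently_close_of_L2_cvg]). A sequence that does not oscillate and
   comes back arbitrarily close to a number converges to it
   ([cvg_of_no_oscillation]).

   It remains to make sense of [phi] as a measurable function on [X x Y], the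
   cocycle being only measurable for the strong operator topology. For [B] a
   measurable subset of [Y], the integral over [B] of [exp (- |psi|)] is a
   strongly continuous function of [psi], so its value at [psi = c(1,x)] is
   measurable in [x] ([SOT_measurable_exp_opp_abs]). As the sigma-algebra of
   a standard Borel space is generated by a countable pi-system
   ([standard_borel_pi_system]), a Radon-Nikodym derivative on the product space
   provides a jointly measurable function equal to [exp (- |c(1,x)|)] almost
   everywhere on [Y], for almost every [x] ([jointly_measurable_version]). *)

(** * Birkhoff sums and the maximal ergodic theorem *)

(** [v] is unbounded above, witnessed along integer thresholds so that the
   condition is a countable one. *)
Definition unbounded_above (R : realType) (v : nat -> R) : Prop :=
  forall K : nat, exists n, K%:R < v n.

Section birkhoff.
Context d (Z : measurableType d) (R : realType) (P : probability Z R).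
Variable T : Z -> Z.
Hypothesis T_mp : measure_preserving P T.

(** The sum of [g] along the first [n] points of the orbit of [z]. *)
Definition birkhoff_sum (g : Z -> R) (n : nat) (z : Z) : R :=
  \sum_(k < n) g (iter k T z).

Lemma birkhoff_sum0 g z : birkhoff_sum g 0 z = 0.
Proof. by rewrite /birkhoff_sum big_ord0. Qed.

Lemma birkhoff_sumS g n z :
  birkhoff_sum g n.+1 z = g z + birkhoff_sum g n (T z).
Proof.
rewrite /birkhoff_sum big_ord_recl; congr (_ + _).
by apply: eq_bigr => k _; rewrite [LHS]/= -iterS iterSr.
Qed.

Lemma birkhoff_sum_affine g (a b : R) n z :
  birkhoff_sum (fun x => a * g x + b) n z = a * birkhoff_sum g n z + b * n%:R.
Proof.
elim: n z => [|n IH] z; first by rewrite !birkhoff_sum0 !mulr0 addr0.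
rewrite !birkhoff_sumS IH -natr1; ring.
Qed.

Lemma measurable_iter n : measurable_fun [set: Z] (iter n T).
Proof.
elim: n => [|n IH]; first exact: measurable_id.
exact: (measurableT_comp (proj1 T_mp) IH).
Qed.

Lemma measurable_birkhoff_sum g n : measurable_fun [set: Z] g ->
  measurable_fun [set: Z] (birkhoff_sum g n).
Proof.
move=> mg; apply: measurable_sum => k.
exact: (measurableT_comp mg (measurable_iter k)).
Qed.

(** The maximum of the Birkhoff sums of [g] of length at most [n], the empty
   sum included; the recursion is [max (0, g + M_n o T)]. *)
Fixpoint maximal_sum (g : Z -> R) (n : nat) (z : Z) : R :=
  if n is n'.+1 then Num.max 0 (g z + maximal_sum g n' (T z)) else 0.

Lemma maximal_sum_ge0 g n z : 0 <= maximal_sum g n z.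
Proof. by case: n => //= n; rewrite le_max lexx. Qed.

Lemma maximal_sum_nd g n m z : (n <= m)%N -> maximal_sum g n z <= maximal_sum g m z.
Proof.
elim: n m z => [|n IH] [|m] z //=; first by rewrite le_max lexx.
rewrite ltnS => nm; rewrite ge_max !le_max lexx /=.
by rewrite lerD2l IH ?orbT.
Qed.

Lemma birkhoff_sum_le_maximal g n z : birkhoff_sum g n z <= maximal_sum g n z.
Proof.
elim: n z => [|n IH] z; first by rewrite birkhoff_sum0.
by rewrite birkhoff_sumS /= le_max lerD2l IH orbT.
Qed.

(** Garsia's inequality: where [M_n > 0], monotonicity in [n] gives
   [M_n = g + M_(n-1) o T <= g + M_n o T]; elsewhere [M_n = 0 <= M_n o T]. *)
Lemma maximal_sum_sub_le g n z :
  maximal_sum g n z - maximal_sum g n (T z) <=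
    (if 0 < maximal_sum g n z then g z else 0).
Proof.
case: ifPn => [|]; last first.
  rewrite -leNgt => M0; rewrite subr_le0.
  exact: le_trans M0 (maximal_sum_ge0 _ _ _).
case: n => [|n]; first by rewrite ltxx.
move=> M0; rewrite lerBlDr.
have -> : maximal_sum g n.+1 z = g z + maximal_sum g n (T z).
  move: M0 => /=; rewrite lt_max ltxx /= => M0.
  by apply/max_idPr/ltW.
by rewrite lerD2l; exact: maximal_sum_nd.
Qed.

Lemma measurable_maximal_sum g n : measurable_fun [set: Z] g ->
  measurable_fun [set: Z] (maximal_sum g n).
Proof.
move=> mg; elim: n => [|n IH] /=; first exact: measurable_cst.
apply: measurable_maxr; first exact: measurable_cst.
apply: measurable_funD => //.
exact: (measurableT_comp IH (proj1 T_mp)).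
Qed.

Lemma eq_integral_pushforward (E : set Z) (h : Z -> \bar R) : measurable E ->
  measurable_fun [set: Z] h ->
  (\int[pushforward P T]_(z in E) h z = \int[P]_(z in E) h z)%E.
Proof.
move=> mE mh; apply: eq_measure_integral; first exact: (proj1 T_mp).
by move=> mT A mA _; exact: (proj2 T_mp).
Qed.

Lemma integrable_mp (h : Z -> R) : P.-integrable [set: Z] (EFin \o h) ->
  P.-integrable [set: Z] (EFin \o (h \o T)).
Proof.
move=> /integrableP[/measurable_EFinP mh hfin]; apply/integrableP; split.
  by apply/measurable_EFinP; exact: (measurableT_comp mh (proj1 T_mp)).
apply: le_lt_trans hfin.
rewrite -[leRHS]eq_integral_pushforward//; last first.
  by apply: measurableT_comp => //; exact/measurable_EFinP.
rewrite ge0_integral_pushforward ?preimage_setT//.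
- exact: (proj1 T_mp).
- by apply: measurableT_comp => //; exact/measurable_EFinP.
Qed.

Lemma integral_mp (E : set Z) (h : Z -> R) : measurable E -> T @^-1` E = E ->
  P.-integrable [set: Z] (EFin \o h) ->
  (\int[P]_(z in E) (h (T z))%:E = \int[P]_(z in E) (h z)%:E)%E.
Proof.
move=> mE TE hi.
have mh : measurable_fun [set: Z] (EFin \o h) by exact: measurable_int hi.
rewrite -[RHS]eq_integral_pushforward// integral_pushforward//; first last.
- apply: (@integrableS _ _ _ _ setT) => //; first by rewrite TE.
  exact: integrable_mp.
- exact: (proj1 T_mp).
by rewrite TE.
Qed.

Lemma integrable_maximal_sum g n : P.-integrable [set: Z] (EFin \o g) ->
  P.-integrable [set: Z] (EFin \o maximal_sum g n).
Proof.
move=> gi; have mg : measurable_fun setT g.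
  exact/measurable_EFinP/(measurable_int _ gi).
elim: n => [|n IH]; first exact: integrable0.
apply: (@le_integrable _ _ _ _ _ measurableT _
    (fun z => (g z)%:E + (maximal_sum g n (T z))%:E)%E) => //.
- exact/measurable_EFinP/measurable_maximal_sum.
- move=> z _ /=; rewrite lee_fin ger0_norm ?le_max ?lexx// ge_max normr_ge0.
  exact: ler_norm.
- exact: integrableD gi (integrable_mp IH).
Qed.

(** Garsia's inequality integrates to [0] on the left over an invariant set,
   and its right-hand side tends to [g] at every point where some Birkhoff sum
   is positive. *)
Lemma maximal_ergodic (g : Z -> R) (E : set Z) :
  P.-integrable [set: Z] (EFin \o g) -> measurable E -> T @^-1` E = E ->
  (forall z, E z -> exists n, 0 < birkhoff_sum g n z) ->
  (0 <= \int[P]_(z in E) (g z)%:E)%E.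
Proof.
move=> gi mE TE Epos.
have mg : measurable_fun setT g by exact/measurable_EFinP/(measurable_int _ gi).
pose u n z : R := if 0 < maximal_sum g n z then g z else 0.
have mu_ n : measurable_fun setT (u n).
  apply: measurable_fun_ifT => //.
  by apply: measurable_fun_ltr => //; exact: measurable_maximal_sum.
have giE : P.-integrable E (EFin \o g) by exact: integrableS gi.
have ug n z : `|u n z| <= `|g z|.
  by rewrite /u; case: ifP => // _; rewrite normr0.
have ui n : P.-integrable E (EFin \o u n).
  apply: (le_integrable mE _ _ giE).
    by apply/measurable_EFinP; exact: measurable_funTS.
  by move=> z _ /=; rewrite lee_fin.
have u_ge0 n : (0 <= \int[P]_(z in E) (u n z)%:E)%E.
  have Mi : P.-integrable E (EFin \o maximal_sum g n).
    by apply: integrableS (integrable_maximal_sum n gi).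
  have MTi : P.-integrable E (EFin \o (maximal_sum g n \o T)).
    by apply: integrableS (integrable_mp (integrable_maximal_sum n gi)).
  have <- : (\int[P]_(z in E)
      ((maximal_sum g n z)%:E - (maximal_sum g n (T z))%:E) = 0)%E.
    rewrite integralB//= integral_mp//; last exact: integrable_maximal_sum.
    by rewrite subee//; exact: integrable_fin_num Mi.
  apply: le_integral => //; [exact: integrableB|exact: ui|].
  by move=> z _; rewrite -EFinB lee_fin; exact: maximal_sum_sub_le.
have [] := @dominated_convergence _ _ _ P E mE (fun n => EFin \o u n)
  (EFin \o g) (EFin \o (fun z => `|g z|)).
- by move=> n; apply/measurable_EFinP; exact: measurable_funTS.
- by apply/measurable_EFinP; exact: measurable_funTS.
- apply: nearW => z Ez; apply: cvg_EFin; first exact: nearW.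
  have [n n0] := Epos z Ez.
  apply: cvg_near_cst; exists n => // m /= nm.
  rewrite /u ifT//; apply: lt_le_trans n0 _.
  by apply: (le_trans (birkhoff_sum_le_maximal _ _ _)); exact: maximal_sum_nd.
- exact: integrable_norm.
- by apply: nearW => z n Ez /=; rewrite lee_fin.
move=> _ _ ucvg; apply: (cvge_to_ge ucvg).
exact: nearW.
Qed.

Lemma measurable_unbounded_above g : measurable_fun [set: Z] g ->
  measurable [set z | unbounded_above (fun n => birkhoff_sum g n z)].
Proof.
move=> mg.
have -> : [set z | unbounded_above (fun n => birkhoff_sum g n z)] =
    \bigcap_K \bigcup_n [set z | K%:R < birkhoff_sum g n z].
  apply/seteqP; split => z /=.
    by move=> zu K _; have [n Kn] := zu K; exists n.
  by move=> zu K; have [n _ Kn] := zu K I; exists n.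
apply: bigcapT_measurable => K; apply: bigcupT_measurable => n.
have := measurable_fun_ltr (measurable_cst (K%:R : R)) (measurable_birkhoff_sum n mg).
by move=> /(_ measurableT [set true] I); rewrite setTI.
Qed.

(** Birkhoff sums at [z] and at [T z] differ by [g z] and a shift of the
   length, so the set of points with unbounded sums is exactly invariant. *)
Lemma unbounded_above_mp g z :
  unbounded_above (fun n => birkhoff_sum g n (T z)) <->
  unbounded_above (fun n => birkhoff_sum g n z).
Proof.
split=> zu K.
- have [n nK] := zu (K + (Num.truncn `|g z|).+1)%N.
  exists n.+1; rewrite birkhoff_sumS.
  move: nK; rewrite natrD => nK.
  have := truncnS_gt `|g z|; have := ler_norm (- g z); rewrite normrN; lra.
- have [[|n] nK] := zu (K + (Num.truncn `|g z|).+1)%N.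
    by move: nK; rewrite birkhoff_sum0 ltNge ler0n.
  exists n; move: nK; rewrite birkhoff_sumS natrD => nK.
  have := truncnS_gt `|g z|; have := ler_norm (g z); lra.
Qed.

(** The part of Birkhoff's theorem that is needed: almost nowhere do the
   Birkhoff averages of an integrable function oscillate between values above
   some [b' > b] and values below some [a' < a]. On the invariant set where the
   sums are unbounded as stated, the maximal ergodic theorem applies
   to both [g - b] and [a - g], whose sum is the negative constant [a - b]. *)
Lemma birkhoff_no_oscillation (g : Z -> R) (a b : R) : a < b ->
  P.-integrable [set: Z] (EFin \o g) ->
  \forall z \ae P,
    ~ (unbounded_above (fun n => birkhoff_sum g n z - b * n%:R) /\
       unbounded_above (fun n => a * n%:R - birkhoff_sum g n z)).
Proof.
move=> ab gi.
have mg : measurable_fun setT g by exact/measurable_EFinP/(measurable_int _ gi).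
pose gb z := 1 * g z + (- b); pose ga z := (-1) * g z + a.
have gbE n z : birkhoff_sum gb n z = birkhoff_sum g n z - b * n%:R.
  by rewrite birkhoff_sum_affine mul1r mulNr.
have gaE n z : birkhoff_sum ga n z = a * n%:R - birkhoff_sum g n z.
  by rewrite birkhoff_sum_affine mulN1r addrC.
have csti (k : R) : P.-integrable setT (EFin \o cst k).
  exact: finite_measure_integrable_cst.
have gbi : P.-integrable setT (EFin \o gb).
  have := integrableB measurableT gi (csti b).
  by apply: eq_integrable => // z _; rewrite /gb /= mul1r EFinD EFinN.
have gai : P.-integrable setT (EFin \o ga).
  have := integrableB measurableT (csti a) gi.
  by apply: eq_integrable => // z _; rewrite /ga /= mulN1r addrC EFinD EFinN.
have mgb : measurable_fun setT gb by exact/measurable_EFinP/(measurable_int _ gbi).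
have mga : measurable_fun setT ga by exact/measurable_EFinP/(measurable_int _ gai).
pose E := [set z | unbounded_above (fun n => birkhoff_sum gb n z)] `&`
          [set z | unbounded_above (fun n => birkhoff_sum ga n z)].
have mE : measurable E by apply: measurableI; exact: measurable_unbounded_above.
have TE : T @^-1` E = E.
  by apply/seteqP; split => z [zb za]; split; exact/unbounded_above_mp.
have PE0 : P E = 0%E.
  have b0 : (0 <= \int[P]_(z in E) (gb z)%:E)%E.
    apply: maximal_ergodic => // z [zb _]; have [n nK] := zb 0%N; by exists n.
  have a0 : (0 <= \int[P]_(z in E) (ga z)%:E)%E.
    apply: maximal_ergodic => // z [_ za]; have [n nK] := za 0%N; by exists n.
  have := adde_ge0 b0 a0.
  rewrite -integralD//; last 2 first.
  - exact: integrableS gbi.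
  - exact: integrableS gai.
  rewrite (eq_integral (cst (a - b)%:E)); last first.
    by move=> z _; rewrite -EFinD /gb /ga; congr EFin; lra.
  rewrite integral_cst// => abE; apply/eqP; rewrite eq_le measure_ge0 andbT.
  rewrite leNgt; apply/negP => PE; move: abE; rewrite leNgt => /negP; apply.
  by rewrite nmule_rlt0// lte_fin subr_lt0.
exists E; split => // z /= /contrapT[zb za].
by split => K /=; [have [n nK] := zb K|have [n nK] := za K]; exists n;
  rewrite ?gbE ?gaE.
Qed.

End birkhoff.

(** * A jointly measurable version of a measurable family of functions *)

Lemma ae_product_section (R : realType) dX (X : measurableType dX)
    dY (Y : measurableType dY) (mu : probability X R) (nu : probability Y R)
    (Q : X * Y -> Prop) :
  (\forall z \ae (mu \x nu)%E, Q z) ->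
  \forall x \ae mu, \forall y \ae nu, Q (x, y).
Proof.
move=> [N [mN N0 QN]].
have mF := measurable_fun_xsection nu mN.
have : (\int[mu]_x `|nu (xsection N x)| = 0)%E.
  rewrite -[RHS]N0; apply: eq_integral => x _; rewrite gee0_abs//.
move/(ae_eq_integral_abs mu measurableT mF); apply: filterS => x /(_ I) Nx0.
exists (xsection N x); split => //; first exact: measurable_xsection.
by move=> y Qy; rewrite /xsection/= inE; exact: QN.
Qed.

Section density_measure.
Context d (T : measurableType d) (R : realType).
Variables (nu : {measure set T -> \bar R}) (f : T -> \bar R).
Hypotheses (mf : measurable_fun [set: T] f) (f0 : forall x, (0 <= f x)%E).

(** The measure with density [f] with respect to [nu]; the two hypotheses on
   [f] are arguments so that the measure structure can be inferred. *)
Definition density_measure of measurable_fun [set: T] f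
  & (forall x, (0 <= f x)%E) := fun A : set T => (\int[nu]_(x in A) f x)%E.

Let m := density_measure mf f0.

Let m0 : m set0 = 0%E.
Proof. by rewrite /m /density_measure integral_set0. Qed.

Let m_ge0 A : (0 <= m A)%E.
Proof. by apply: integral_ge0. Qed.

Let m_sigma_additive : semi_sigma_additive m.
Proof. exact: semi_sigma_additive_nng_induced. Qed.

HB.instance Definition _ := isMeasure.Build _ _ _ (density_measure mf f0)
  m0 m_ge0 m_sigma_additive.

End density_measure.

Section jointly_measurable_version.
Context (R : realType) dX (X : measurableType dX) dY (Y : measurableType dY).
Variables (mu : probability X R) (nu : probability Y R).
Variable k : X -> Y -> R.
Hypothesis k_ge0 : forall x y, 0 <= k x y.
Hypothesis k_le1 : forall x y, k x y <= 1.
Hypothesis mk : forall x, measurable_fun [set: Y] (k x).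
Hypothesis mkX : forall B, measurable B ->
  measurable_fun [set: X] (fun x => \int[nu]_(y in B) (k x y)%:E)%E.

Let kE_ge0 x y : (0 <= (k x y)%:E)%E. Proof. by rewrite lee_fin. Qed.

Let mkE x : measurable_fun [set: Y] (EFin \o k x).
Proof. exact/measurable_EFinP. Qed.

(* the finite kernel sending [x] to the measure of density [k x] *)
Let kernel_of x : {measure set Y -> \bar R} := density_measure nu (mkE x) (kE_ge0 x).

HB.instance Definition _ := isKernel.Build _ _ X Y R kernel_of mkX.

Let kernel_of_le1 x B : measurable B -> (kernel_of x B <= 1)%E.
Proof.
move=> mB; rewrite -(@probability_setT _ _ _ nu).
apply: (@le_trans _ _ (nu B)); last by rewrite le_measure ?inE.
rewrite -[leRHS]mul1e -integral_cst//.
apply: ge0_le_integral => //.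
- by move=> y _; exact: kE_ge0.
- exact: measurable_funTS.
- by move=> y _ /=; rewrite lee_fin.
Qed.

Let kernel_of_uub : measure_fam_uub kernel_of.
Proof.
exists 2 => x; apply: (le_lt_trans (kernel_of_le1 x measurableT)).
by rewrite lte_fin ltr1n.
Qed.

HB.instance Definition _ := Kernel_isFinite.Build _ _ X Y R kernel_of kernel_of_uub.

(* the measure k(x, y) mu(dx) nu(dy), which makes sense although [k] is not
   known to be jointly measurable *)
Let m (E : set (X * Y)) : \bar R := (\int[mu]_x kernel_of x (xsection E x))%E.

Let m_meas E : measurable E ->
  measurable_fun [set: X] (fun x => kernel_of x (xsection E x)).
Proof.
move=> mE; apply: measurable_fun_xsection_finite_kernel.
by rewrite inE.
Qed.

Let m0 : m set0 = 0%E.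
Proof. by rewrite /m integral0_eq// => x _; rewrite xsection0 measure0. Qed.

Let m_ge0 E : (0 <= m E)%E.
Proof. by apply: integral_ge0. Qed.

Let m_sigma_additive : semi_sigma_additive m.
Proof.
move=> F mF tF mUF.
rewrite [X in _ --> X](_ : _ = (\sum_(n <oo) m (F n))%E).
  by apply/cvg_closeP; split; [exact: is_cvg_nneseries|rewrite closeE].
rewrite -integral_nneseries//; last by move=> n; exact: m_meas.
apply: eq_integral => x _; apply/esym/cvg_lim => //=; rewrite xsection_bigcup.
apply: (measure_sigma_additive _ (trivIset_xsection tF)) => ?.
exact: measurable_xsection.
Qed.

HB.instance Definition _ := isMeasure.Build _ _ _ m m0 m_ge0 m_sigma_additive.

Let m_fin : fin_num_fun m.
Proof.
apply: lty_fin_num_fun; apply: (@le_lt_trans _ _ 1%E); last exact: ltry.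
rewrite -(@probability_setT _ _ _ mu) -[leRHS]mul1e -integral_cst//.
apply: ge0_le_integral => //; first exact: m_meas.
by move=> x _; apply: kernel_of_le1; exact: measurable_xsection.
Qed.

HB.instance Definition _ := Measure_isFinite.Build _ _ _ m m_fin.

Let m_dominated : m `<< (mu \x nu)%E.
Proof.
apply/null_content_dominatesP => N mN N0.
rewrite /m.
have mF := measurable_fun_xsection nu mN.
have : (\int[mu]_x `|nu (xsection N x)| = 0)%E.
  by rewrite -[RHS]N0; apply: eq_integral => x _; rewrite gee0_abs.
move/(ae_eq_integral_abs mu measurableT mF) => Nae.
rewrite (ae_eq_integral (cst 0%E)) ?integral0//; first exact: m_meas.
apply: filterS Nae => x /(_ I) Nx0 _; apply: null_set_integral => //.
  exact: measurable_xsection.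
exact: measurable_funTS.
Qed.

Variable G : nat -> set Y.
Hypothesis G_gen : @measurable dY Y = <<s range G >>.
Hypothesis G_setI : setI_closed (range G).
Hypothesis G_setT : range G setT.

(** Only the integrals of [k x] over the measurable subsets of [Y] are known to
   be measurable in [x]. The Radon-Nikodym derivative of the measure
   k(x, y) mu(dx) nu(dy) with respect to the product measure is a jointly
   measurable version of [k]: for each set of a countable pi-system
   generating the sigma-algebra of [Y], both functions have the same integral
   over it for almost every [x], hence for almost every [x] they define the
   same measure on [Y]. *)
Lemma jointly_measurable_version : exists h : X * Y -> R,
  measurable_fun [set: X * Y] h /\
  \forall x \ae mu, \forall y \ae nu, h (x, y) = k x y.
Proof.
pose P : probability (X * Y)%type R := (mu \x nu)%E.
have [h [h_ge0 h_fin h_int hE]] :=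
  @radon_nikodym_sigma_finite _ (X * Y)%type R P m m_dominated.
have mh : measurable_fun setT h by exact: measurable_int h_int.
exists (fine \o h); split; first exact: measurableT_comp.
have mhx x : measurable_fun [set: Y] (fun y => h (x, y)).
  exact: measurable_fun_pair2.
have int_prod A B : measurable A -> measurable B ->
    (\int[(mu \x nu)%E]_(z in A `*` B) h z =
     \int[mu]_(x in A) \int[nu]_(y in B) h (x, y))%E.
  move=> mA mB; rewrite integral_mkcond fubini_tonelli1/=; last 2 first.
  - by apply/measurable_restrict => //; [exact: measurableX|rewrite setTI; exact: measurable_funTS].
  - by move=> z; rewrite patchE; case: ifP.
  rewrite [RHS]integral_mkcond; apply: eq_integral => x _.
  rewrite /fubini_F patchE; case: ifPn => xA.
    rewrite [RHS]integral_mkcond; apply: eq_integral => y _.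
    by rewrite !patchE in_setX/= xA.
  by apply: integral0_eq => y _; rewrite patchE in_setX/= (negbTE xA).
have mhB B : measurable B ->
    measurable_fun [set: X] (fun x => \int[nu]_(y in B) h (x, y))%E.
  move=> mB.
  have -> : (fun x => \int[nu]_(y in B) h (x, y))%E =
      fubini_F nu (h \_ ([set: X] `*` B)).
    apply/funext => x; rewrite integral_mkcond; apply: eq_integral => y _.
    by rewrite !patchE in_setX/= in_setT.
  apply: measurable_fun_fubini_tonelli_F.
    apply/measurable_restrict => //; first exact: measurableX.
    by rewrite setTI; exact: measurable_funTS.
  by move=> z; rewrite patchE; case: ifP.
have agree B : measurable B ->
    \forall x \ae mu, kernel_of x B = (\int[nu]_(y in B) h (x, y))%E.
  move=> mB.
  have kB_int : mu.-integrable setT (kernel_of ^~ B).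
    apply/integrableP; split; first exact: (measurable_kernel kernel_of).
    apply: (@le_lt_trans _ _ 1%E); last exact: ltry.
    rewrite -(@probability_setT _ _ _ mu) -[leRHS]mul1e -integral_cst//.
    apply: ge0_le_integral => //.
      by apply: measurableT_comp => //; exact: (measurable_kernel kernel_of).
    by move=> x _; rewrite gee0_abs//; exact: kernel_of_le1.
  suff H : ae_eq mu setT (kernel_of ^~ B)
      (fun x => \int[nu]_(y in B) h (x, y))%E.
    by apply: filterS H => x; exact.
  apply: (integral_ae_eq measurableT kB_int (mhB B mB)).
  move=> A _ mA; rewrite -int_prod// -hE; last exact: measurableX.
  rewrite /= /m [LHS]integral_mkcond; apply: eq_integral => x _.
  rewrite patchE; case: ifPn => xA; first by rewrite in_xsectionX.
  by rewrite notin_xsectionX// measure0.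
have mG i : measurable (G i).
  by rewrite G_gen; apply: sub_sigma_algebra; exists i.
have : \forall x \ae mu, forall i, kernel_of x (G i) = (\int[nu]_(y in G i) h (x, y))%E.
  by apply/ae_foralln => i; exact: agree.
apply: filterS => x agreeG.
pose mhx_ := density_measure nu (mhx x) (fun y => h_ge0 (x, y)).
have [iT _ GT] := G_setT.
have agreeB B : measurable B -> kernel_of x B = mhx_ B.
  apply: (measure_unique (range G) (fun=> G iT)) => //.
  - by rewrite GT bigcup_const.
  - by move=> _ [i _ <-]; exact: agreeG.
  - move=> _; apply: (le_lt_trans (kernel_of_le1 x (mG _))); exact: ltry.
have kx_int : nu.-integrable setT (EFin \o k x).
  apply/integrableP; split => //.
  under eq_integral do rewrite /= ger0_norm//.
  apply: (le_lt_trans (kernel_of_le1 x measurableT)); exact: ltry.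
have := @integral_ae_eq _ _ _ nu setT measurableT _ _ kx_int (mhx x).
move=> /(_ (fun E _ mE => agreeB E mE)); apply: filterS => y /(_ I) /= <-.
by [].
Qed.

End jointly_measurable_version.

(** * Countable generation of standard Borel spaces *)

Lemma second_countable_of_dense (R : realType) (P : pseudoMetricType R)
    (D : set P) : countable D -> dense D ->
  exists U : nat -> set P, (forall n, open (U n)) /\
    forall O, open O -> forall x, O x -> exists n, U n x /\ U n `<=` O.
Proof.
move=> /countable_injP[e einj] Ddense.
(* the balls need not be open, hence the interiors; the union over [d] ranges
   over at most one point, by injectivity of [e] *)
pose B i k : set P :=
  \bigcup_(d in [set d | D d /\ e d = i]) (ball d (k.+1%:R^-1 : R))°.
pose U (n : nat) : set P :=
  if unpickle n is Some (i, k) then B i k else set0.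
exists U; split.
  move=> n; rewrite /U; case: unpickle => [[i k]|]; last exact: open0.
  by apply: bigcup_open => d _; exact: open_interior.
move=> O Oopen x Ox.
have /nbhs_ballP[r /= r0 rO] : nbhs x O by exact: open_nbhs_nbhs.
have [k] : exists k : nat, 0 + k.+1%:R^-1 < r / 2.
  by apply: ltr_add_invr; rewrite divr_gt0.
rewrite add0r => kr.
have k0 : (0 : R) < k.+1%:R^-1 / 2 by rewrite divr_gt0// invr_gt0.
have [d [xd Dd]] : ((ball x (k.+1%:R^-1 / 2))° `&` D) !=set0.
  apply: Ddense; last exact: open_interior.
  by exists x; exact: nbhsx_ballx.
have {}xd := interior_subset xd.
exists (pickle (e d, k)); rewrite /U pickleK; split.
  exists d => //; apply: (filterS _ (nbhsx_ballx x _ k0)) => z xz.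
  rewrite [k.+1%:R^-1]splitr; apply: ball_triangle xz; exact: ball_sym.
move=> z [d' [Dd' ed']] /interior_subset d'z; apply: rO.
have dd' : d' = d by apply: einj; rewrite ?inE.
rewrite dd' in d'z.
apply: (@le_ball _ _ _ (k.+1%:R^-1 / 2 + k.+1%:R^-1)); last exact: ball_triangle d'z.
move: kr k0; set q : R := k.+1%:R^-1; move: q => q; lra.
Qed.

Lemma standard_borel_pi_system (R : realType) d (Y : measurableType d) :
  standard_borel R Y -> exists G : nat -> set Y,
    [/\ @measurable d Y = <<s range G >>, setI_closed (range G) &
        range G setT].
Proof.
move=> [P [g [_ [D Dcountable Ddense] _ mE]]].
have [U [Uopen Ubase]] := second_countable_of_dense Dcountable Ddense.
pose W (s : seq nat) : set Y := \big[setI/setT]_(i <- s) (g @^-1` U i).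
pose G n := if unpickle n is Some s then W s else setT.
have GW s : range G (W s) by exists (pickle s) => //; rewrite /G pickleK.
have WG n : exists s, G n = W s.
  rewrite /G; case: unpickle => [s|]; first by exists s.
  by exists [::]; rewrite /W big_nil.
have mgU i : measurable (g @^-1` U i).
  by apply/mE; exists (U i) => //; apply: sub_sigma_algebra; exact: Uopen.
exists G; split.
- apply/seteqP; split => A.
    move=> /mE[B sB ->].
    pose C := image_set_system setT g <<s range G >>.
    have CE V : C V = <<s range G >> (g @^-1` V).
      by rewrite /C/= /image_set_system/mkset setTI.
    rewrite -CE.
    apply: (smallest_sub _ _ sB).
      by apply: sigma_algebra_image; exact: smallest_sigma_algebra.
    move=> O Oopen; rewrite CE.
    have -> : g @^-1` O = \bigcup_n
        (if `[< U n `<=` O >] then g @^-1` U n else set0).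
      apply/seteqP; split => y /=.
        move=> Oy; have [n [Un UO]] := Ubase O Oopen _ Oy.
        by exists n => //; case: asboolP.
      by move=> [n _]; case: asboolP => // UO; exact: UO.
    apply: sigma_algebra_bigcup => n; case: asboolP => _; last first.
      exact: sigma_algebra0.
    apply: sub_sigma_algebra.
    by have := GW [:: n]; rewrite /W big_seq1.
  apply: smallest_sub; first exact: sigma_algebra_measurable.
  move=> _ [n _ <-]; have [s ->] := WG n.
  by rewrite /W; apply: bigsetI_measurable.
- move=> _ _ [n _ <-] [m _ <-]; have [s ->] := WG n; have [t ->] := WG m.
  by have := GW (s ++ t); rewrite /W big_cat.
- by have := GW [::]; rewrite /W big_nil.
Qed.

(** * Measurability in the strong operator topology *)

Section modulus.
Context (R : realType) d (Y : measurableType d).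
Implicit Types phi psi : Y -> R[i].

Lemma cabsE phi y : (cabs phi y)%:C = `|phi y|.
Proof. by rewrite /cabs normc_def. Qed.

Lemma cabs_sqrtE phi y :
  cabs phi y = Num.sqrt (complex.Re (phi y) ^+ 2 + complex.Im (phi y) ^+ 2).
Proof. by rewrite /cabs normc_def. Qed.

Lemma cabs_ge0 phi y : 0 <= cabs phi y.
Proof. by rewrite cabs_sqrtE sqrtr_ge0. Qed.

Lemma cabsM phi psi y :
  cabs (fun y => phi y * psi y) y = cabs phi y * cabs psi y.
Proof. by apply: complexI; rewrite rmorphM/= !cabsE normrM. Qed.

Lemma cabs_real (f : Y -> R) y : cabs (fun y => (f y)%:C) y = `|f y|.
Proof. by rewrite cabs_sqrtE /= expr0n addr0 sqrtr_sqr. Qed.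

Lemma cabs_le_addB phi psi y :
  cabs psi y <= cabs phi y + cabs (fun y => psi y - phi y) y.
Proof.
rewrite -lecR rmorphD/= !cabsE -[X in `|X| <= _](subrKC (phi y)).
exact: ler_normD.
Qed.

End modulus.

Lemma expR_opp_lipschitz (R : realType) (s t e : R) :
  0 <= s -> 0 <= e -> t <= s + e -> expR (- s) <= expR (- t) + e.
Proof.
move=> s0 e0 tse.
have h1 : expR (- s) * (1 - e) <= expR (- t).
  apply: (@le_trans _ _ (expR (- s) * expR (- e))).
    by rewrite ler_pM2l ?expR_gt0// -[1 - e]/(1 + - e) expR_ge1Dx.
  by rewrite -expRD ler_expR; lra.
have h2 : expR (- s) <= 1 by rewrite -expR0 ler_expR; lra.
have h3 := expR_gt0 (- s).
nra.
Qed.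

Section strong_measurability.
Context (R : realType) d (Y : measurableType d) (nu : probability Y R).

Lemma measurable_cabs (phi : Y -> R[i]) :
  cmeasurable phi -> measurable_fun [set: Y] (cabs phi).
Proof.
move=> [mRe mIm]; rewrite (_ : cabs phi = fun y =>
  Num.sqrt (complex.Re (phi y) ^+ 2 + complex.Im (phi y) ^+ 2)); last first.
  by apply/funext => y; exact: cabs_sqrtE.
apply: (measurableT_comp (continuous_measurable_fun (@sqrt_continuous R))).
by apply: measurable_funD; exact: measurable_funX.
Qed.

Lemma cmeasurableB (phi psi : Y -> R[i]) : cmeasurable phi -> cmeasurable psi ->
  cmeasurable (fun y => phi y - psi y).
Proof.
move=> [fr fi] [sr si]; split.
- rewrite (_ : (fun y => _) =
    (fun y => complex.Re (phi y) - complex.Re (psi y))); last first.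
    by apply/funext => y; rewrite raddfB.
  exact: measurable_funB.
- rewrite (_ : (fun y => _) =
    (fun y => complex.Im (phi y) - complex.Im (psi y))); last first.
    by apply/funext => y; rewrite raddfB.
  exact: measurable_funB.
Qed.

Lemma LC2_cst1 : LC nu 2%:E (cst 1).
Proof.
split; first by split; exact: measurable_cst.
rewrite /finite_norm (_ : EFin \o cabs (cst 1) = cst 1%E).
  by rewrite Lnorm_cst1 [X in (X `^ _)%E](probability_setT nu) poweR1r ltry.
by apply/funext => y /=; rewrite cabs_sqrtE /= expr1n expr0n addr0 sqrtr1.
Qed.

Lemma integral_le_Lnorm2 (h : Y -> R) : measurable_fun [set: Y] h ->
  (\int[nu]_y `|(h y)%:E| <= Lnorm nu 2%:E (EFin \o h))%E.
Proof.
move=> mh; have := hoelder nu mh (measurable_cst (1 : R)) (ltr0n _ 2) (ltr0n _ 2).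
rewrite -mulr2n -[_ *+ 2]mulr_natr mulVf// => /(_ erefl).
rewrite [X in (_ <= _ * X)%E](_ : _ = 1%E) ?mule1; last first.
  by rewrite (Lnorm_cst1 nu 2) [X in (X `^ _)%E](probability_setT nu) poweR1r.
rewrite Lnorm1; apply: le_trans.
by under [leRHS]eq_integral do rewrite /= mulr1.
Qed.

(** The function [exp (- |phi|)]: bounded, so that it can serve as a density
   without any integrability assumption, Lipschitz in [|phi|], and [|phi|]
   can be recovered from it. *)
Definition exp_opp_abs (phi : Y -> R[i]) (y : Y) : R := expR (- cabs phi y).

Lemma measurable_exp_opp_abs (phi : Y -> R[i]) :
  cmeasurable phi -> measurable_fun [set: Y] (exp_opp_abs phi).
Proof.
move=> mphi; apply: measurableT_comp; first exact: measurable_expR.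
by apply: measurableT_comp => //; exact: measurable_cabs.
Qed.

Lemma exp_opp_abs_le1 phi y : exp_opp_abs phi y <= 1.
Proof. by rewrite /exp_opp_abs -expR0 ler_expR oppr_le0 cabs_ge0. Qed.

Lemma integral_exp_opp_abs_le1 (B : set Y) phi : measurable B ->
  cmeasurable phi -> (\int[nu]_(y in B) (exp_opp_abs phi y)%:E <= 1)%E.
Proof.
move=> mB mphi; apply: (@le_trans _ _ (nu B)); last exact: probability_le1.
rewrite -[leRHS]mul1e -integral_cst//.
apply: ge0_le_integral => //.
- by move=> y _; rewrite lee_fin expR_ge0.
- by apply/measurable_EFinP/measurable_funTS; exact: measurable_exp_opp_abs.
- by move=> y _; rewrite lee_fin; exact: exp_opp_abs_le1.
Qed.

(** If [psi] is close to [phi] when applied to the vector [1], then the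
   integrals over [B] of [exp (- |phi|)] and [exp (- |psi|)] are close. *)
Lemma SOT_open_exp_opp_abs (B : set Y) (a : R) : measurable B ->
  SOT_open nu [set phi | LC nu +oo%E phi /\
    (a%:E < \int[nu]_(y in B) (exp_opp_abs phi y)%:E)%E].
Proof.
move=> mB; split => [phi []//|phi [Lphi aphi]].
have mphi := proj1 Lphi.
have phi_fin : (\int[nu]_(y in B) (exp_opp_abs phi y)%:E \is a fin_num)%E.
  rewrite ge0_fin_numE; last by apply: integral_ge0 => y _; rewrite lee_fin expR_ge0.
  by apply: le_lt_trans (integral_exp_opp_abs_le1 mB mphi) _; exact: ltry.
pose e := fine (\int[nu]_(y in B) (exp_opp_abs phi y)%:E) - a.
exists 1%N, (fun=> cst 1), e; split.
- by move=> _; exact: LC2_cst1.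
- by rewrite /e subr_gt0 -lte_fin fineK.
move=> psi Lpsi /(_ ord0) close; split => //.
have mpsi := proj1 Lpsi.
pose h := cabs (fun y => psi y - phi y).
have mh : measurable_fun setT h by apply/measurable_cabs/cmeasurableB.
have he : (\int[nu]_(y in B) (h y)%:E < e%:E)%E.
  apply: le_lt_trans close.
  rewrite /L2norm (_ : cabs _ = h); last first.
    by apply/funext => y; rewrite /mulop /h; congr cabs; apply/funext => z; rewrite mulr1.
  apply: le_trans (integral_le_Lnorm2 mh).
  under [leRHS]eq_integral do rewrite abse_EFin ger0_norm ?cabs_ge0//.
  apply: ge0_subset_integral => //; first exact/measurable_EFinP.
  by move=> y _; rewrite lee_fin cabs_ge0.
have key : (\int[nu]_(y in B) (exp_opp_abs phi y)%:E <=
    \int[nu]_(y in B) (exp_opp_abs psi y)%:E + \int[nu]_(y in B) (h y)%:E)%E.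
  have mBE g : measurable_fun setT g -> measurable_fun B (EFin \o g).
    by move=> mg; apply/measurable_EFinP/measurable_funTS.
  rewrite -ge0_integralD//; last 4 first.
  - by move=> y _; rewrite lee_fin expR_ge0.
  - by apply: mBE; exact: measurable_exp_opp_abs.
  - by move=> y _; rewrite lee_fin cabs_ge0.
  - exact: mBE.
  apply: ge0_le_integral => //.
  - by move=> y _; rewrite lee_fin expR_ge0.
  - by apply: mBE; exact: measurable_exp_opp_abs.
  - apply: emeasurable_funD; last exact: mBE.
    by apply: mBE; exact: measurable_exp_opp_abs.
  move=> y _; rewrite -EFinD lee_fin.
  by apply: expR_opp_lipschitz; rewrite ?cabs_ge0 ?cabs_le_addB.
rewrite -(@lteD2rE _ e%:E)// -EFinD [in X in (X%:E < _)%E]/e addrC subrK fineK//.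
apply: le_lt_trans key _; rewrite lteD2lE//.
rewrite ge0_fin_numE; last by apply: integral_ge0 => y _; rewrite lee_fin expR_ge0.
by apply: le_lt_trans (integral_exp_opp_abs_le1 mB mpsi) _; exact: ltry.
Qed.

Lemma SOT_measurable_exp_opp_abs dX (X : measurableType dX)
    (F : X -> Y -> R[i]) (B : set Y) : (forall x, LC nu +oo%E (F x)) ->
  SOT_measurable nu F -> measurable B ->
  measurable_fun [set: X] (fun x => \int[nu]_(y in B) (exp_opp_abs (F x) y)%:E)%E.
Proof.
move=> LF mF mB.
apply: (measurability _ (ErealGenOInfty.measurableE R)) => // _ [_ [a ->] <-].
rewrite setTI.
have := mF _ (SOT_open_exp_opp_abs a mB); congr measurable.
apply/seteqP; split => x /=; rewrite in_itv/= andbT.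
  by case.
by move=> ax; split.
Qed.

End strong_measurability.

(** * Multiplication by a characteristic function *)

Lemma ge0_le_poweR (R : realType) (r : R) (x y : \bar R) :
  0 <= r -> (0 <= x)%E -> (x <= y)%E -> (x `^ r <= y `^ r)%E.
Proof.
move=> r0 x0 xy; apply: gt0_ler_poweR => //; rewrite in_itv/= leey andbT//.
exact: le_trans xy.
Qed.

Section L2_functions.
Context (R : realType) d (Y : measurableType d) (nu : probability Y R).

Lemma measurable_abse_poweR2 (h : Y -> R) : measurable_fun [set: Y] h ->
  measurable_fun [set: Y] (fun y => `|(h y)%:E| `^ 2)%E.
Proof.
move=> mh; apply: (measurableT_comp (measurable_poweR 2)).
by apply: measurableT_comp => //; exact/measurable_EFinP.
Qed.

Lemma le_Lnorm2 (f g : Y -> R) :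
  measurable_fun [set: Y] f -> measurable_fun [set: Y] g ->
  (\forall y \ae nu, `|f y| <= `|g y|) ->
  (Lnorm nu 2%:E (EFin \o f) <= Lnorm nu 2%:E (EFin \o g))%E.
Proof.
move=> mf mg fg; rewrite unlock /Lnorm.
apply: ge0_le_poweR => //.
  by apply: integral_ge0 => y _; exact: poweR_ge0.
apply: ae_ge0_le_integral => //.
- by move=> y _; exact: poweR_ge0.
- exact: measurable_abse_poweR2.
- by move=> y _; exact: poweR_ge0.
- exact: measurable_abse_poweR2.
apply: filterS fg => y fgy _.
by apply: ge0_le_poweR => //; rewrite lee_fin.
Qed.

Lemma Lnorm2Z_le (f : Y -> R) (a : R) : measurable_fun [set: Y] f -> 0 <= a ->
  (Lnorm nu 2%:E (EFin \o (fun y => (a * f y)%R)) <=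
    a%:E * Lnorm nu 2%:E (EFin \o f))%E.
Proof.
move=> mf a0; rewrite unlock /Lnorm.
rewrite (eq_integral (fun y => a%:E `^ 2 * `|(f y)%:E| `^ 2)%E); last first.
  by move=> y _; rewrite [(EFin \o _) y]EFinM abseM poweRM// gee0_abs.
rewrite ge0_integralZl//; last 3 first.
- exact: measurable_abse_poweR2.
- by move=> y _; exact: poweR_ge0.
- exact: poweR_ge0.
rewrite poweRM ?poweR_ge0//; last first.
  by apply: integral_ge0 => y _; exact: poweR_ge0.
by rewrite -poweRrM mulfV// poweRe1.
Qed.

Lemma cmeasurableM (phi psi : Y -> R[i]) : cmeasurable phi -> cmeasurable psi ->
  cmeasurable (fun y => phi y * psi y).
Proof.
move=> [fr fi] [sr si]; split.
- rewrite (_ : (fun y => _) = (fun y =>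
    complex.Re (phi y) * complex.Re (psi y) -
    complex.Im (phi y) * complex.Im (psi y))); last first.
    by apply/funext => y; case: (phi y); case: (psi y).
  by apply: measurable_funB; exact: measurable_funM.
- rewrite (_ : (fun y => _) = (fun y =>
    complex.Re (phi y) * complex.Im (psi y) +
    complex.Im (phi y) * complex.Re (psi y))); last first.
    by apply/funext => y; case: (phi y); case: (psi y) => a b a' b' /=.
  by apply: measurable_funD; exact: measurable_funM.
Qed.

Lemma cmeasurableD (phi psi : Y -> R[i]) : cmeasurable phi -> cmeasurable psi ->
  cmeasurable (fun y => phi y + psi y).
Proof.
move=> [fr fi] [sr si]; split.
- rewrite (_ : (fun y => _) =
    (fun y => complex.Re (phi y) + complex.Re (psi y))); last first.
    by apply/funext => y; rewrite raddfD.
  exact: measurable_funD.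
- rewrite (_ : (fun y => _) =
    (fun y => complex.Im (phi y) + complex.Im (psi y))); last first.
    by apply/funext => y; rewrite raddfD.
  exact: measurable_funD.
Qed.

Lemma cmeasurable_cst (a : R[i]) : cmeasurable (cst a : Y -> R[i]).
Proof. by split; exact: measurable_cst. Qed.

Lemma cmeasurable_conj (phi : Y -> R[i]) : cmeasurable phi ->
  cmeasurable (fun y => (phi y)^*).
Proof.
move=> [fr fi]; split.
- rewrite (_ : (fun y => _) = (fun y => complex.Re (phi y)))//.
  by apply/funext => y; case: (phi y).
- rewrite (_ : (fun y => _) = (fun y => - complex.Im (phi y))).
    exact: measurableT_comp.
  by apply/funext => y; case: (phi y).
Qed.

Lemma cmeasurable_real (f : Y -> R) : measurable_fun [set: Y] f ->
  cmeasurable (fun y => (f y)%:C).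
Proof. by move=> mf; split => //=; exact: measurable_cst. Qed.

Lemma LC2_le (phi : Y -> R[i]) (g : Y -> R) : cmeasurable phi ->
  measurable_fun [set: Y] g -> (forall y, cabs phi y <= `|g y|) ->
  finite_norm nu 2%:E g -> LC nu 2%:E phi.
Proof.
move=> mphi mg le fing; split => //; apply: le_lt_trans fing.
apply: le_Lnorm2 => //; first exact: measurable_cabs.
by apply: nearW => y; rewrite ger0_norm ?cabs_ge0.
Qed.

Lemma LC2_lincomb (a : R[i]) (xi eta : Y -> R[i]) :
  LC nu 2%:E xi -> LC nu 2%:E eta -> LC nu 2%:E (fun y => a * xi y + eta y).
Proof.
move=> [mxi fxi] [meta feta].
have [mx my] := (measurable_cabs mxi, measurable_cabs meta).
pose b : R := complex.Re `|a|.
have bE : b%:C = `|a| by rewrite /b normc_def.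
have b0 : 0 <= b by rewrite /b normc_def sqrtr_ge0.
apply: (LC2_le (g := fun y => b * cabs xi y + cabs eta y)).
- by apply: cmeasurableD => //; apply: cmeasurableM => //; exact: cmeasurable_cst.
- by apply: measurable_funD => //; exact: measurable_funM.
- move=> y; apply: le_trans (ler_norm _).
  rewrite -lecR rmorphD rmorphM/= bE !cabsE -normrM; exact: ler_normD.
apply: le_lt_trans (minkowski_EFin nu _ _ _) _.
- exact: measurable_funM.
- exact: my.
- by rewrite ler1n.
apply: lte_add_pinfty => //.
apply: le_lt_trans (Lnorm2Z_le mx b0) _.
by rewrite lte_mul_pinfty ?lee_fin.
Qed.

Lemma LC2_cst0 : LC nu 2%:E (cst 0).
Proof.
have [m1 f1] := LC2_cst1 nu.
apply: (LC2_le (g := cabs (cst 1))) => //.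
  exact: measurable_cabs.
move=> y; apply: le_trans (ler_norm _).
by rewrite -lecR !cabsE /= normr0 normr1 ler01.
Qed.

End L2_functions.

Section multiplication_by_indicator.
Context (R : realType) d (Y : measurableType d) (nu : probability Y R).
Variable B : set Y.
Hypothesis mB : measurable B.

(** The square-integrable functions vanishing almost everywhere on [B]: the
   range of the multiplication by the characteristic function of [~` B]. *)
Definition vanishing_on : set (Y -> R[i]) :=
  [set xi | LC nu 2%:E xi /\ \forall y \ae nu, B y -> xi y = 0].

(** The characteristic function of [~` B], as a complex-valued function. *)
Definition indicC (y : Y) : R[i] := (\1_(~` B) y : R)%:C.

Lemma measurable_indicC : cmeasurable indicC.
Proof.
apply: cmeasurable_real; apply: measurable_indic; exact: measurableC.
Qed.

Lemma indicC_in y : B y -> indicC y = 0.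
Proof. by move=> By; rewrite /indicC indicE memNset. Qed.

Lemma indicC_notin y : ~ B y -> indicC y = 1.
Proof. by move=> By; rewrite /indicC indicE mem_set. Qed.

Lemma cabs_indicC_le1 y : cabs indicC y <= 1.
Proof.
rewrite -lecR cabsE; have [By|By] := pselect (B y).
  by rewrite indicC_in// normr0 ler01.
by rewrite indicC_notin// normr1.
Qed.

Lemma LC2_mulop_indicC xi : LC nu 2%:E xi -> LC nu 2%:E (mulop indicC xi).
Proof.
move=> [mxi fxi]; apply: (LC2_le (g := cabs xi)) => //.
- by apply: cmeasurableM => //; exact: measurable_indicC.
- exact: measurable_cabs.
move=> y; rewrite ger0_norm ?cabs_ge0// cabsM.
by rewrite ler_piMl ?cabs_ge0 ?cabs_indicC_le1.
Qed.

(** Closedness: if [u n] vanishes on [B] and tends to [xi], then the norm of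
   [xi] restricted to [B] is at most the norm of [u n - xi] for all [n]. *)
Lemma closed_subspace_vanishing_on : closed_subspace nu vanishing_on.
Proof.
split.
- by move=> xi [].
- by split; [exact: LC2_cst0|exact: nearW].
- move=> a xi eta [Lxi xi0] [Leta eta0]; split; first exact: LC2_lincomb.
  by apply: filterS2 xi0 eta0 => y x0 e0 By; rewrite x0// e0// mulr0 addr0.
move=> u xi Su Lxi ucvg; split => //.
have mxi := proj1 Lxi.
pose w y := \1_B y * cabs xi y.
have mw : measurable_fun [set: Y] w.
  by apply: measurable_funM; [exact: measurable_indic|exact: measurable_cabs].
have wle n : (Lnorm nu 2%:E (EFin \o w) <= L2norm nu (fun y => (u n y - xi y)%R))%E.
  apply: le_Lnorm2 => //.
    by apply/measurable_cabs/cmeasurableB => //; have [[]] := Su n.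
  have [_] := Su n; apply: filterS => y un0.
  rewrite [leRHS]ger0_norm ?cabs_ge0//.
  rewrite /w indicE; case: (boolP (y \in B)) => [yB|_]; last first.
    by rewrite mul0r normr0 cabs_ge0.
  rewrite mul1r ger0_norm ?cabs_ge0// -lecR !cabsE un0 ?sub0r ?normrN//.
  exact: set_mem.
have w0 : Lnorm nu 2%:E (EFin \o w) = 0%E.
  apply/eqP; rewrite eq_le Lnorm_ge0 andbT.
  by apply: (cvge_to_ge ucvg); exact: nearW.
have : EFin \o w = \0%E %[ae nu].
  by apply: Lnorm_eq0_eq0 w0 => //; exact/measurable_EFinP.
apply: filterS => y /(_ I) /= [wy] By.
apply/eqP; rewrite -normr_eq0 -cabsE.
by move: wy; rewrite /w indicE mem_set// mul1r => ->.
Qed.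

Lemma orthogonal_projection_indicC :
  orthogonal_projection nu vanishing_on indicC.
Proof.
move=> xi Lxi; split.
  split; first exact: LC2_mulop_indicC.
  by apply: nearW => y By; rewrite /mulop indicC_in// mul0r.
move=> eta [Leta eta0]; rewrite /L2dot /cintegral.
pose g y := (xi y - mulop indicC xi y) * (eta y)^*.
have [mgr mgi] : cmeasurable g.
  apply: cmeasurableM; last exact/cmeasurable_conj/(proj1 Leta).
  apply: cmeasurableB; first exact: (proj1 Lxi).
  by apply: cmeasurableM; [exact: measurable_indicC|exact: (proj1 Lxi)].
have g0 : \forall y \ae nu, g y = 0.
  apply: filterS eta0 => y e0; rewrite /g /mulop; have [By|By] := pselect (B y).
    by rewrite e0// conjC0 mulr0.
  by rewrite indicC_notin// mul1r subrr mul0r.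
have int0 (h : Y -> R) : measurable_fun [set: Y] h ->
    (\forall y \ae nu, h y = 0) -> \int[nu]_y h y = 0.
  move=> mh h0; rewrite /Rintegral (ae_eq_integral (cst 0%E)) ?integral0//.
    exact/measurable_EFinP.
  by apply: filterS h0 => y ->.
rewrite -/(g _) !int0//.
- by apply: filterS g0 => y; rewrite -/(g y) => ->.
- by apply: filterS g0 => y; rewrite -/(g y) => ->.
Qed.

Lemma LCoo_indicC : LC nu +oo%E indicC.
Proof.
split; first exact: measurable_indicC.
rewrite /finite_norm unlock /Lnorm; case: ifP => _; last exact: lt0y.
apply: (@le_lt_trans _ _ 1%E); last exact: ltry.
apply/ess_supP; apply: nearW => y /=.
by rewrite lee_fin ger0_norm ?cabs_ge0// cabs_indicC_le1.
Qed.

Lemma tau_subr_indicC (eps : R) : (nu B < eps%:E)%E ->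
  tau nu (fun y => 1 - indicC y) < eps%:C.
Proof.
move=> Beps.
have -> : (fun y => 1 - indicC y) = (fun y => (\1_B y : R)%:C).
  apply/funext => y; have [By|By] := pselect (B y).
    by rewrite indicC_in// indicE mem_set// subr0.
  by rewrite indicC_notin// indicE memNset// subrr.
rewrite /tau /cintegral /= /Rintegral integral0/= integral_indic// setIT.
rewrite -[X in X < _]/((fine (nu B))%:C) ltcR.
by rewrite -lte_fin fineK// fin_num_measure.
Qed.

Lemma opnorm_real_le (f : Y -> R) (e : R) : 0 <= e -> measurable_fun [set: Y] f ->
  (forall y, `|f y| <= e) -> (opnorm nu (fun y => (f y)%:C) <= e%:E)%E.
Proof.
move=> e0 mf fe; apply: ereal_inf_lbound => /=; exists e => //; split => // xi Lxi.
have mxi := measurable_cabs (proj1 Lxi).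
apply: le_trans (Lnorm2Z_le nu mxi e0).
apply: le_Lnorm2.
- by apply/measurable_cabs/cmeasurableM; [exact: cmeasurable_real|exact: (proj1 Lxi)].
- exact: measurable_funM.
apply: nearW => y.
rewrite [leLHS]ger0_norm ?cabs_ge0// cabsM cabs_real [leRHS]ger0_norm; last first.
  by rewrite mulr_ge0 ?cabs_ge0.
by rewrite ler_wpM2r ?cabs_ge0.
Qed.

Lemma opnorm_ge0 (phi : Y -> R[i]) : (0 <= opnorm nu phi)%E.
Proof. by apply: le_ereal_inf_tmp => _ [r [r0 _] <-]; rewrite lee_fin. Qed.

Lemma opnorm_cvg0_of_uniform (T : nat -> Y -> R) (L : Y -> R) :
  (forall n, measurable_fun [set: Y] (T n)) -> measurable_fun [set: Y] L ->
  {uniform ~` B, T @ \oo --> L} ->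
  opnorm nu (fun y => (T n y)%:C * indicC y - (L y)%:C * indicC y)
    @[n --> \oo] --> 0%E.
Proof.
move=> mT mL TL.
have small (e : R) : 0 < e -> \forall n \near \oo,
    (opnorm nu (fun y => (T n y)%:C * indicC y - (L y)%:C * indicC y)%R <= e%:E)%E.
  move=> e0.
  have : \forall n \near \oo, forall y, (~` B) y -> ball (L y) e (T n y).
    apply: (TL [set h | forall y, (~` B) y -> ball (L y) e (h y)]).
    apply/uniform_nbhs; exists [set xy | ball xy.1 e xy.2]; split => //.
    exact: (entourage_ball _ (PosNum e0)).
  apply: filterS => n Tn.
  rewrite (_ : (fun y => _) = (fun y => ((T n y - L y) * \1_(~` B) y)%:C)); last first.
    by apply/funext => y; rewrite -mulrBl rmorphM/= rmorphB.
  apply: opnorm_real_le; first exact: ltW.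
    apply: measurable_funM; first exact: measurable_funB.
    by apply: measurable_indic; exact: measurableC.
  move=> y; rewrite indicE; case: (boolP (y \in ~` B)) => [/set_mem yB|_].
    by have := Tn y yB; rewrite /ball/= mulr1 distrC => /ltW.
  by rewrite mulr0 normr0 ltW.
apply/fine_cvgP; split.
  apply: filterS (small 1 ltr01) => n n1.
  by rewrite ge0_fin_numE ?opnorm_ge0// (le_lt_trans n1)// ltry.
apply/cvgrPdist_le => e e0; apply: filterS (small e e0) => n ne /=.
rewrite sub0r normrN ger0_norm ?fine_ge0 ?opnorm_ge0//.
rewrite -lee_fin fineK// ge0_fin_numE ?opnorm_ge0//.
by rewrite (le_lt_trans ne)// ltry.
Qed.

End multiplication_by_indicator.

(** Egorov's theorem: outside a set [B] of small measure the convergence is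
   uniform, and the projection is the characteristic function of [~` B]. *)
Lemma cvg_almost_uniformly_of_ae (R : realType) d (Y : measurableType d)
    (nu : probability Y R) (T : nat -> Y -> R) (L : Y -> R) :
  (forall n, measurable_fun [set: Y] (T n)) -> measurable_fun [set: Y] L ->
  (\forall y \ae nu, T n y @[n --> \oo] --> L y) ->
  cvg_almost_uniformly nu T L.
Proof.
move=> mT mL TL eps eps0.
have [B [mB Beps BTL]] : exists B, [/\ measurable B, (nu B < eps%:E)%E &
    {uniform setT `\` B, T @ \oo --> L}].
  apply: ae_pointwise_almost_uniform => //.
    by rewrite -ge0_fin_numE// fin_num_measure.
  by apply: filterS TL => y TLy _.
exists (vanishing_on nu B), (indicC R B); split.
- exact: closed_subspace_vanishing_on.
- exact: LCoo_indicC.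
- exact: orthogonal_projection_indicC.
- exact: tau_subr_indicC.
- by apply: opnorm_cvg0_of_uniform => //; rewrite -setTD.
Qed.

(** * From non-oscillation to convergence *)

Lemma unbounded_above_linear (R : realType) (v : nat -> R) (delta : R) :
  0 < delta -> (forall N, exists2 n, (N <= n)%N & delta * n%:R <= v n) ->
  unbounded_above v.
Proof.
move=> d0 vd K; have [n Nn vn] := vd (Num.truncn (K%:R / delta)).+1.
exists n; apply: lt_le_trans vn; rewrite mulrC -ltr_pdivrMr//.
by apply: lt_le_trans (truncnS_gt _) _; rewrite ler_nat.
Qed.

(** The averages come back arbitrarily close to [L]; were they frequently at
   distance [e] from [L], they would oscillate across a rational interval
   separating [L] from [L + e] or from [L - e]. *)
Lemma cvg_of_no_oscillation (R : realType) (S : nat -> R) (L : R) :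
  (forall e N, 0 < e -> exists2 n, (N <= n)%N & `|n%:R^-1 * S n - L| < e) ->
  (forall a b : rat, a < b ->
    ~ (unbounded_above (fun n => S n - ratr b * n%:R) /\
       unbounded_above (fun n => ratr a * n%:R - S n))) ->
  n%:R^-1 * S n @[n --> \oo] --> L.
Proof.
move=> Lclose noosc.
have mulE n : (0 < n)%N -> S n = n%:R^-1 * S n * n%:R.
  by move=> n0; rewrite mulrAC mulVf ?mul1r// pnatr_eq0 -lt0n.
have close e : 0 < e -> forall N, exists2 n, (N <= n)%N &
    ((L - e) * n%:R <= S n) /\ (S n <= (L + e) * n%:R).
  move=> e0 N; have [n Nn] := Lclose e N.+1 e0.
  rewrite ltr_norml => /andP[le1 le2]; exists n; first exact: ltnW.
  rewrite (mulE n) ?(leq_trans _ Nn)//.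
  by split; rewrite ler_wpM2r ?ler0n//; lra.
have nofreq_gt e : 0 < e ->
    ~ (forall N, exists2 n, (N <= n)%N & (L + e) * n%:R <= S n).
  move=> e0 freq.
  have [a] : exists q : rat, ratr q \in `]L, (L + e)[.
    by apply: rat_in_itvoo; rewrite ltrDl.
  rewrite in_itv/= => /andP[La ae].
  have [b] := rat_in_itvoo ae.
  rewrite in_itv/= => /andP[ab be]; apply: (noosc a b); first by rewrite -(ltr_rat R).
  split.
  - apply: (@unbounded_above_linear _ _ (L + e - ratr b)); first by rewrite subr_gt0.
    by move=> N; have [n Nn Sn] := freq N; exists n => //; lra.
  - apply: (@unbounded_above_linear _ _ ((ratr a - L) / 2)); first by lra.
    move=> N; have [] := close ((ratr a - L) / 2) _ N; first by lra.
    by move=> n Nn [_ Sn]; exists n => //; lra.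
have nofreq_lt e : 0 < e ->
    ~ (forall N, exists2 n, (N <= n)%N & S n <= (L - e) * n%:R).
  move=> e0 freq.
  have [a] : exists q : rat, ratr q \in `](L - e), L[.
    by apply: rat_in_itvoo; rewrite gtrBl.
  rewrite in_itv/= => /andP[La ae].
  have [b] := rat_in_itvoo ae.
  rewrite in_itv/= => /andP[ab be]; apply: (noosc a b); first by rewrite -(ltr_rat R).
  split.
  - apply: (@unbounded_above_linear _ _ ((L - ratr b) / 2)); first by lra.
    move=> N; have [] := close ((L - ratr b) / 2) _ N; first by lra.
    by move=> n Nn [Sn _]; exists n => //; lra.
  - apply: (@unbounded_above_linear _ _ (ratr a - (L - e))); first by rewrite subr_gt0.
    by move=> N; have [n Nn Sn] := freq N; exists n => //; lra.
apply/cvgrPdist_le => e e0.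
have [N1 gt1] : exists N, forall n, (N <= n)%N -> S n < (L + e) * n%:R.
  apply: contrapT => nogt; apply: (nofreq_gt e e0) => N.
  apply: contrapT => nofreq; apply: nogt; exists N => n Nn.
  by rewrite ltNge; apply/negP => Sn; apply: nofreq; exists n.
have [N2 lt2] : exists N, forall n, (N <= n)%N -> (L - e) * n%:R < S n.
  apply: contrapT => nolt; apply: (nofreq_lt e e0) => N.
  apply: contrapT => nofreq; apply: nolt; exists N => n Nn.
  by rewrite ltNge; apply/negP => Sn; apply: nofreq; exists n.
exists (maxn N1 N2).+1 => // n /= Nn.
have n0 : 0 < n%:R :> R by rewrite ltr0n (leq_trans _ Nn).
have h1 := gt1 n (leq_trans (leq_maxl N1 N2) (ltnW Nn)).
have h2 := lt2 n (leq_trans (leq_maxr N1 N2) (ltnW Nn)).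
rewrite -ltr_pdivrMr// mulrC in h1; rewrite -ltr_pdivlMr// mulrC in h2.
by rewrite distrC ler_norml; apply/andP; split; lra.
Qed.

(** The set where [|w n| >= 1 / (k + 1)] for all [n >= N] is null, by Markov's
   inequality. *)
Lemma frequently_close_of_L2_cvg (R : realType) d (Y : measurableType d)
    (nu : probability Y R) (w : nat -> Y -> R) :
  (forall n, measurable_fun [set: Y] (w n)) ->
  Lnorm nu 2%:E (EFin \o w n) @[n --> \oo] --> 0%E ->
  \forall y \ae nu, forall e N, 0 < e -> exists2 n, (N <= n)%N & `|w n y| < e.
Proof.
move=> mw wcvg.
pose A k N := \bigcap_(n in [set n | (N <= n)%N]) [set y | k.+1%:R^-1 <= `|w n y|].
have mA k N : measurable (A k N).
  apply: bigcap_measurable => [|n _]; first by exists N => /=.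
  have := measurable_fun_ler (measurable_cst (k.+1%:R^-1 : R))
    (measurableT_comp (@normr_measurable R setT) (mw n)).
  by move=> /(_ measurableT [set true] I); rewrite setTI.
have A0 k N : nu (A k N) = 0%E.
  apply/eqP; rewrite eq_le measure_ge0 andbT.
  have k0 : 0 < k.+1%:R^-1 :> R by rewrite invr_gt0.
  rewrite -(@lee_pmul2l _ (k.+1%:R^-1)%:E) ?mule0 ?fin_numE//.
  apply: (cvge_to_ge wcvg); exists N => // n /= Nn.
  apply: le_trans (integral_le_Lnorm2 nu (mw n)).
  rewrite -integral_cst//.
  apply: (@le_trans _ _ (\int[nu]_(y in A k N) `|(w n y)%:E|)%E).
    apply: ge0_le_integral => //.
    - by move=> y _; rewrite lee_fin ltW.
    - apply: measurable_funTS; apply: measurableT_comp => //.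
      exact/measurable_EFinP.
    - by move=> y /(_ n Nn) /= kw; rewrite lee_fin.
  apply: ge0_subset_integral => //.
  by apply: measurableT_comp => //; exact/measurable_EFinP.
have : \forall y \ae nu, forall k N, ~ A k N y.
  apply/ae_foralln => k; apply/ae_foralln => N.
  by exists (A k N); split; [exact: mA|exact: A0|move=> y /= /contrapT].
apply: filterS => y nA e N e0.
have [k] := ltr_add_invr e0; rewrite add0r => ke.
apply: contrapT => noclose; apply: (nA k N) => n /= Nn.
rewrite leNgt; apply/negP => wk; apply: noclose; exists n => //.
exact: lt_trans ke.
Qed.

(** * Measure-preserving maps and integrals *)

Lemma ae_measure_preserving (R : realType) d (X : measurableType d)
    (mu : probability X R) (f : X -> X) (Q : X -> Prop) :
  measure_preserving mu f -> (\forall x \ae mu, Q x) ->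
  \forall x \ae mu, Q (f x).
Proof.
move=> [mf muf] [N [mN N0 QN]]; exists (f @^-1` N); split.
- by rewrite -[X in measurable X]setTI; exact: mf.
- by rewrite -N0; exact: muf.
- by move=> x; exact: QN.
Qed.

Lemma measure_preserving_iter (R : realType) d (X : measurableType d)
    (mu : probability X R) (f : X -> X) n :
  measure_preserving mu f -> measure_preserving mu (iter n f).
Proof.
move=> fmp; elim: n => [|n [mfn mun]]; first by split; [exact: measurable_id|].
split; first exact: measurable_iter fmp n.+1.
move=> A mA; have [mf muf] := fmp.
have mfA : measurable (f @^-1` A) by rewrite -[X in measurable X]setTI; exact: mf.
by rewrite -(muf A mA) -(mun _ mfA).
Qed.

Lemma measure_preserving_prod (R : realType) dX (X : measurableType dX)
    dY (Y : measurableType dY) (mu : probability X R) (nu : probability Y R)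
    (f : X -> X) : measure_preserving mu f ->
  measure_preserving ((mu \x nu)%E : probability (X * Y)%type R)
    (fun z => (f z.1, z.2)).
Proof.
move=> fmp; have [mf _] := fmp.
have mT : measurable_fun [set: X * Y] (fun z => (f z.1, z.2)).
  apply/measurable_fun_pairP; split; last exact: measurable_snd.
  exact: (measurableT_comp mf measurable_fst).
split => // A mA; rewrite /= /product_measure1.
have mF := measurable_fun_xsection nu mA.
rewrite -[RHS](eq_integral_pushforward fmp measurableT mF).
by rewrite ge0_integral_pushforward// preimage_setT.
Qed.

(** Monotonicity of the integral when the larger function is not assumed
   measurable: its integral is a supremum over the simple functions below it. *)
Lemma le_integral_nonmeasurable (R : realType) d (X : measurableType d)
    (mu : probability X R) (F G : X -> \bar R) :
  measurable_fun [set: X] F -> (forall x, 0 <= F x)%E -> (forall x, 0 <= G x)%E ->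
  (\forall x \ae mu, (F x <= G x)%E) -> (\int[mu]_x F x <= \int[mu]_x G x)%E.
Proof.
move=> mF F0 G0 [N [mN N0 FGN]].
rewrite (ge0_negligible_integral mN)// integral_mkcond.
rewrite !ge0_integralTE//; last by move=> x; rewrite patchE; case: ifP.
apply: ereal_sup_le => _ [h hF <-]; exists h => // x.
apply: le_trans (hF x) _; rewrite patchE; case: ifPn => // /set_mem[_ Nx].
by apply: contrapT => FG; apply: Nx; exact: FGN.
Qed.

(** * The logarithm of the cocycle *)

Section log_modulus.
Context (R : realType) d (Y : measurableType d).
Implicit Types phi : Y -> R[i].

(** Also true for [n = 0] and where [phi] vanishes: [0^-1 = 0] and [ln 0 = 0]. *)
Lemma log_root_absqE n phi : log_root_absq n phi =
  (fun y => n%:R^-1 * log_abs phi y).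
Proof.
apply/funext => y; rewrite /log_root_absq /log_abs ln_powR.
have -> : complex.Re ((phi y)^* * phi y) = cabs phi y ^+ 2.
  rewrite cabs_sqrtE sqr_sqrtr ?addr_ge0 ?sqr_ge0//.
  by case: (phi y) => a b /=; rewrite mulNr opprK !expr2.
have [c0|c0] := ltP 0 (cabs phi y); last first.
  by rewrite (_ : cabs phi y = 0) ?expr0n ?ln0 ?mulr0//; apply/eqP;
    rewrite eq_le c0 cabs_ge0.
rewrite lnXn// natrM invfM -[ln _ *+ 2]mulr_natl mulrACA mulVf ?mul1r//.
Qed.

Lemma measurable_log_abs phi : cmeasurable phi ->
  measurable_fun [set: Y] (log_abs phi).
Proof.
by move=> mphi; apply: measurableT_comp; [exact: measurable_ln|exact: measurable_cabs].
Qed.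

End log_modulus.

Section version_of_cocycle.
Context (R : realType) dX (X : measurableType dX) dY (Y : measurableType dY).
Variables (mu : probability X R) (nu : probability Y R).
Hypothesis stdY : standard_borel R Y.

(** The version is [ln (- ln h)] for a jointly measurable version [h] of
   [exp (- |c x|)]. *)
Lemma jointly_measurable_log_abs (c : X -> Y -> R[i]) :
  (forall x, LC nu +oo%E (c x)) -> SOT_measurable nu c ->
  exists phi : X * Y -> R, measurable_fun [set: X * Y] phi /\
    \forall x \ae mu, \forall y \ae nu, phi (x, y) = log_abs (c x) y.
Proof.
move=> Lc mc; have [G [G_gen G_setI G_setT]] := standard_borel_pi_system stdY.
have [h [mh hE]] := jointly_measurable_version mu (nu := nu)
  (k := fun x => exp_opp_abs (c x)) (fun x y => expR_ge0 _)
  (fun x y => exp_opp_abs_le1 (c x) y)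
  (fun x => measurable_exp_opp_abs (proj1 (Lc x)))
  (fun B mB => SOT_measurable_exp_opp_abs Lc mc mB) G_gen G_setI G_setT.
exists (fun z => ln (- ln (h z))); split.
  apply: measurableT_comp; first exact: measurable_ln.
  apply: measurableT_comp => //.
  by apply: measurableT_comp; first exact: measurable_ln.
apply: filterS hE => x; apply: filterS => y ->.
by rewrite /exp_opp_abs expRK opprK.
Qed.

(** The [L^1] norm of each section is at most its [L^2] norm, [nu] being a
   probability. *)
Lemma integrable_of_L2_sections (phi : X * Y -> R) (g : X -> Y -> R) :
  measurable_fun [set: X * Y] phi ->
  (forall x, measurable_fun [set: Y] (g x)) ->
  (\forall x \ae mu, \forall y \ae nu, phi (x, y) = g x y) ->
  (\int[mu]_x Lnorm nu 2%:E (EFin \o g x) < +oo)%E ->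
  (mu \x nu)%E.-integrable [set: X * Y] (EFin \o phi).
Proof.
move=> mphi mg phig g_int.
have mabs : measurable_fun [set: X * Y] (fun z => `|(phi z)%:E|%E).
  by apply: measurableT_comp => //; exact/measurable_EFinP.
apply/integrableP; split; first exact/measurable_EFinP.
apply: le_lt_trans g_int.
rewrite fubini_tonelli1//.
apply: le_integral_nonmeasurable.
- exact: measurable_fun_fubini_tonelli_F.
- by move=> x; exact: integral_ge0.
- by move=> x; exact: Lnorm_ge0.
apply: filterS phig => x phix.
apply: le_trans (integral_le_Lnorm2 nu (mg x)).
rewrite /fubini_F (ge0_ae_eq_integral (g := fun y => `|(g x y)%:E|%E))//.
- exact: (measurable_fun_pair2 x mabs).
- by apply: measurableT_comp => //; exact/measurable_EFinP.
- by apply: filterS phix => y phixy _ /=; rewrite phixy.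
Qed.

End version_of_cocycle.

Lemma iter_prod (X Y : Type) (f : X -> X) k x (y : Y) :
  iter k (fun z : X * Y => (f z.1, z.2)) (x, y) = (iter k f x, y).
Proof. by elim: k => //= k ->. Qed.

(** The cocycle relation makes [log |c(n, x)|] additive along orbits, that is,
   a Birkhoff sum for the map [f x id] of the product space. *)
Lemma log_abs_cocycle (R : realType) dX (X : measurableType dX)
    dY (Y : measurableType dY) (mu : probability X R) (nu : probability Y R)
    (f finv : X -> X) (c : int -> X -> Y -> R[i]) (phi : X * Y -> R) :
  measure_preserving mu f ->
  (forall n x, \forall y \ae nu, c n x y != 0) ->
  (forall n m : int, \forall x \ae mu, \forall y \ae nu,
      c (n + m) x y = c n (iterz f finv m x) y * c m x y) ->
  (\forall x \ae mu, \forall y \ae nu, phi (x, y) = log_abs (c 1 x) y) ->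
  \forall x \ae mu, \forall y \ae nu, forall n : nat, log_abs (c n%:Z x) y =
    birkhoff_sum (fun z : X * Y => (f z.1, z.2)) phi n (x, y).
Proof.
move=> fmp c_neq0 c_cocycle phiE.
have c_step : \forall x \ae mu, forall n : nat, \forall y \ae nu,
    c (1 + n%:Z) x y = c 1 (iter n f x) y * c n%:Z x y.
  by apply/ae_foralln => n; exact: (c_cocycle 1 n%:Z).
have phi_iter : \forall x \ae mu, forall n : nat, \forall y \ae nu,
    phi (iter n f x, y) = log_abs (c 1 (iter n f x)) y.
  apply/ae_foralln => n.
  exact: ae_measure_preserving (measure_preserving_iter n fmp) phiE.
have c_0 := c_cocycle 0 0.
near=> x.
have step : \forall y \ae nu, forall n : nat,
    c (1 + n%:Z) x y = c 1 (iter n f x) y * c n%:Z x y.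
  by apply/ae_foralln; near: x.
have phis : \forall y \ae nu, forall n : nat,
    phi (iter n f x, y) = log_abs (c 1 (iter n f x)) y.
  by apply/ae_foralln; near: x.
have neq0 : \forall y \ae nu, forall n : nat, c n%:Z x y != 0.
  by apply/ae_foralln => n; exact: c_neq0.
have neq0_0 := c_neq0 0 x.
have neq0_iter : \forall y \ae nu, forall n : nat, c 1 (iter n f x) y != 0.
  by apply/ae_foralln => n; exact: c_neq0.
have zero : \forall y \ae nu, c (0 + 0) x y = c 0 (iterz f finv 0 x) y * c 0 x y.
  by near: x.
have cabs_gt0 (psi : Y -> R[i]) y : psi y != 0 -> cabs psi y \is Num.pos.
  by move=> psi0; rewrite posrE -ltcR cabsE normr_gt0.
near=> y; elim => [|n IH].
  rewrite birkhoff_sum0.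
  (* [c 0 x y] is nonzero and equal to its square, hence equal to [1] *)
  have cy : c 0 x y != 0 by near: y.
  have /eqP : c (0 + 0) x y = c 0 (iterz f finv 0 x) y * c 0 x y by near: y.
  rewrite addr0 /= -[X in X == _]mul1r (inj_eq (mulIf cy)) => /eqP c1.
  by rewrite /log_abs (_ : cabs _ y = 1) ?ln1//; apply: complexI; rewrite cabsE -c1 normr1.
have -> : log_abs (c n.+1%:Z x) y =
    log_abs (c 1 (iter n f x)) y + log_abs (c n%:Z x) y.
  rewrite /log_abs -lnM ?cabs_gt0//; last 2 first.
  - by move: n {IH}; near: y.
  - by move: n {IH}; near: y.
  congr ln; apply: complexI; rewrite rmorphM/= !cabsE -normrM; congr `|_|.
  by rewrite intS; move: n {IH}; near: y.
have -> : log_abs (c 1 (iter n f x)) y = phi (iter n f x, y).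
  by symmetry; move: n {IH}; near: y.
by rewrite IH /birkhoff_sum big_ord_recr/= iter_prod addrC.
Unshelve. all: by end_near. Qed.

Theorem theorem2p2 (R : realType)
    (dX : measure_display) (X : measurableType dX) (mu : probability X R)
    (dY : measure_display) (Y : measurableType dY) (nu : probability Y R)
    (stdX : standard_borel R X) (stdY : standard_borel R Y)
    (f finv : X -> X) (fK : cancel f finv) (finvK : cancel finv f)
    (f_mp : measure_preserving mu f) (finv_meas : measurable_fun setT finv)
    (f_erg : ergodic mu f)
    (c : int -> X -> Y -> R[i])
    (c_val : forall n x, (Mtimes nu `&` GL2 nu) (c n x))
    (c_cocycle : forall n m : int, \forall x \ae mu, \forall y \ae nu,
      c (n + m) x y = c n (iterz f finv m x) y * c m x y)
    (c_meas : forall n, SOT_measurable nu (c n))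
    (c_int : (\int[mu]_x Lnorm nu 2%:E (EFin \o log_abs (c 1%R x)) < +oo)%E)
    (Lambda : X -> Y -> R)
    (Lambda_lim : \forall x \ae mu,
      [/\ measurable_fun setT (Lambda x),
          \forall y \ae nu, 0 < Lambda x y,
          finite_norm nu 2%:E (fun y => ln (Lambda x y)) &
          Lnorm nu 2%:E (EFin \o (fun y =>
              (n%:R)^-1 * log_abs (c n%:Z x) y - ln (Lambda x y)))
            @[n --> \oo] --> 0%E]) :
  \forall x \ae mu,
    cvg_almost_uniformly nu (fun n => log_root_absq n (c n%:Z x))
      (fun y => ln (Lambda x y)).
Proof.
have c_Loo n x : LC nu +oo%E (c n x) by have [[]] := c_val n x.
have c_neq0 n x : \forall y \ae nu, c n x y != 0 by have [[]] := c_val n x.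
have mc n x : measurable_fun [set: Y] (log_abs (c n x)).
  by apply: measurable_log_abs; exact: (proj1 (c_Loo n x)).
have [phi [mphi phiE]] := jointly_measurable_log_abs mu stdY (c_Loo 1) (c_meas 1).
have phi_int := integrable_of_L2_sections mphi (mc 1) phiE c_int.
pose P : probability (X * Y)%type R := (mu \x nu)%E.
pose T (z : X * Y) := (f z.1, z.2).
have T_mp : measure_preserving P T := measure_preserving_prod nu f_mp.
(* enumeration of the pairs of rationals; the default value is immaterial *)
pose rat_pair (n : nat) : rat * rat := odflt (0, 1) (unpickle n).
have noosc : \forall z \ae P, forall n, let: (a, b) := rat_pair n in a < b ->
    ~ (unbounded_above (fun n => birkhoff_sum T phi n z - ratr b * n%:R) /\
       unbounded_above (fun n => ratr a * n%:R - birkhoff_sum T phi n z)).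
  apply/ae_foralln => n; case: (rat_pair n) => a b.
  have [ab|ab] := boolP (a < b); last exact: nearW.
  have ab' : (ratr a : R) < ratr b by rewrite ltr_rat.
  by apply: filterS (birkhoff_no_oscillation T_mp ab' phi_int) => z nz _.
have cocycle := log_abs_cocycle f_mp c_neq0 c_cocycle phiE.
have := ae_product_section noosc.
move: cocycle Lambda_lim; apply: filterS3 => x cx [mL _ _ Lcvg] nx.
have mlnL : measurable_fun [set: Y] (fun y => ln (Lambda x y)).
  by apply: measurableT_comp => //; exact: measurable_ln.
have mu_ n : measurable_fun [set: Y] (fun y => n%:R^-1 * log_abs (c n%:Z x) y).
  by apply: measurable_funM => //; exact: measurable_cst.
apply: cvg_almost_uniformly_of_ae => //.
  by move=> n; rewrite log_root_absqE.
have close := frequently_close_of_L2_cvg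
  (fun n => measurable_funB (mu_ n) mlnL) Lcvg.
move: cx nx close; apply: filterS3 => y cy ny closey.
under eq_fun do rewrite log_root_absqE cy.
apply: cvg_of_no_oscillation => [e N e0|a b ab].
  by have [n Nn ne] := closey e N e0; exists n => //; rewrite -cy.
by have := ny (pickle (a, b)); rewrite /rat_pair pickleK/=; exact.
Qed.
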